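(* Let $\mathcal U$ and $\mathcal V$ be universal Martin-Löf tests. Then $\mathsf{RD}_{\mathcal V}\equiv_{\mathrm W}\mathsf{LAY}_{\mathcal U}$.
   Context: Cantor space $2^\omega$, Lebesgue measure $\lambda$. A Martin-Löf (ML) test is a sequence $(\mathcal V_i)_{i\in\omega}$ of open subsets of $2^\omega$ such that $\{\langle i,\sigma\rangle:[\sigma]\subseteq\mathcal V_i\}$ is c.e. and $\lambda(\mathcal V_i)\le 2^{-i}$; it is universal if $\bigcap_i\mathcal V'_i\subseteq\bigcap_i\mathcal V_i$ for every ML-test $\mathcal V'$. $\mathrm{MLR}$ is the set of Martin-Löf random sequences ($=2^\omega\setminus\bigcap_i\mathcal U_i$ for any universal $\mathcal U$); for $X\in\mathrm{MLR}$, $\mathrm{rd}_{\mathcal U}(X)=\min\{i:X\notin\mathcal U_i\}$. A representation of a set $X$ is a surjective partial map $\delta_X:\subseteq\omega^\omega\to X$. A realizer of a multi-valued partial function $f:\subseteq X\rightrightarrows Y$ is a partial $\Gamma:\subseteq\omega^\omega\to\omega^\omega$ with $\delta_Y(\Gamma(p))\in f(\delta_X(p))$ for all $p\in\mathrm{dom}(f\circ\delta_X)$. $f\le_{\mathrm W} g$ (Weihrauch reducibility) if there are Turing functionals $\Phi,\Psi$ such that $p\mapsto\Psi(\langle p,\Gamma(\Phi(p))\rangle)$ realizes $f$ for every realizer $\Gamma$ of $g$; $\equiv_{\mathrm W}$ means reducibility in both directions. $\mathrm{MLR}$ is represented by the identity on $\mathrm{MLR}\subseteq\omega^\omega$, $\omega$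 by $\chi_{\{n\}}\mapsto n$. For universal $\mathcal U$: $\mathsf{LAY}_{\mathcal U}\colon\mathrm{MLR}\rightrightarrows\omega$, $\mathsf{LAY}_{\mathcal U}(X)=\{i:X\notin\mathcal U_i\}$; $\mathsf{RD}_{\mathcal U}\colon\mathrm{MLR}\to\omega$, $\mathsf{RD}_{\mathcal U}(X)=\mathrm{rd}_{\mathcal U}(X)$. *)

(* Defs.v *)
From mathcomp Require Import all_boot.
Set Implicit Arguments. Unset Strict Implicit. Unset Printing Implicit Defensive.

Definition npair (x y : nat) : nat := ((x + y) * (x + y).+1) %/ 2 + y.

(* Inverse enumeration of the diagonals: unpair (npair x y) = (x, y). *)
Fixpoint unpair (n : nat) : nat * nat :=
  match n with
  | 0 => (0, 0)
  | n'.+1 => let: (x, y) := unpair n' in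
             if x is x'.+1 then (x', y.+1) else (y.+1, 0)
  end.

Inductive code : Type :=
| CZero | CSucc | CId | CFst | CSnd | COrc
| CComp of code & code
| CPair of code & code
| CRec of code & code
| CMu of code.

Inductive eval (o : nat -> nat) : code -> nat -> nat -> Prop :=
| eZero x : eval o CZero x 0
| eSucc x : eval o CSucc x x.+1
| eId x : eval o CId x x
| eFst x : eval o CFst x (unpair x).1
| eSnd x : eval o CSnd x (unpair x).2
| eOrc x : eval o COrc x (o x)
| eComp f g x y z : eval o g x y -> eval o f y z -> eval o (CComp f g) x z
| ePair f g x y z : eval o f x y -> eval o g x z -> eval o (CPair f g) x (npair y z)
| eRec0 f g x y : eval o f x y -> eval o (CRec f g) (npair x 0) y
| eRecS f g x n y z : eval o (CRec f g) (npair x n) y ->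
    eval o g (npair x (npair n y)) z -> eval o (CRec f g) (npair x n.+1) z
| eMu f x n : eval o f (npair x n) 0 ->
    (forall m, m < n -> exists k, eval o f (npair x m) k.+1) ->
    eval o (CMu f) x n.

Definition baire := nat -> nat.

Definition TF (e : code) (p q : baire) : Prop := forall n, eval p e n (q n).

(* Computably enumerable sets of naturals: domains of partial recursive
   functions (oracle-free computation; the oracle is constantly 0). *)
Definition halts (e : code) (n : nat) : Prop := exists y, eval (fun _ => 0) e n y.

Definition cantor := nat -> bool.

(* bijective coding of binary strings by naturals *)
Fixpoint scode (s : seq bool) : nat :=
  match s with [::] => 0 | b :: s' => (scode s').*2 + 1 + b end.

Definition cyl (s : seq bool) (X : cantor) : Prop := mkseq X (size s) = s.

Definition subset (A B : cantor -> Prop) : Prop := forall X, A X -> B X.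

Definition is_open (V : cantor -> Prop) : Prop :=
  forall X, V X -> exists n, subset (cyl (mkseq X n)) V.

Fixpoint strings (N : nat) : seq (seq bool) :=
  match N with
  | 0 => [:: [::]]
  | N'.+1 => [seq b :: s | b <- [:: false; true], s <- strings N']
  end.

(* lambda(V) <= 2^-i for an open set V: every finite union of basic
   cylinders contained in V has Lebesgue measure <= 2^-i; the measure of
   the union of the cylinders [s], s in F, all of length <= N, is
   #{t in 2^N | some s in F is a prefix of t} / 2^N. *)
Definition measure_le_pow2 (V : cantor -> Prop) (i : nat) : Prop :=
  forall (F : seq (seq bool)) (N : nat),
    (forall s, s \in F -> subset (cyl s) V) ->
    (forall s, s \in F -> size s <= N) ->
    count (fun t => has (fun s => prefix s t) F) (strings N) * 2 ^ i <= 2 ^ N.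

Definition ML_test (V : nat -> cantor -> Prop) : Prop :=
  [/\ forall i, is_open (V i),
      (exists e, forall i s, subset (cyl s) (V i) <-> halts e (npair i (scode s)))
    & forall i, measure_le_pow2 (V i) i].

Definition universal (U : nat -> cantor -> Prop) : Prop :=
  ML_test U /\
  forall W, ML_test W -> forall X, (forall i, W i X) -> forall i, U i X.

Definition MLR (X : cantor) : Prop :=
  forall W, ML_test W -> exists i, ~ W i X.

Definition delta_MLR (p : baire) (X : cantor) : Prop :=
  MLR X /\ forall n, p n = nat_of_bool (X n).

Definition delta_nat (p : baire) (n : nat) : Prop :=
  forall m, p m = nat_of_bool (m == n).

(* G (a partial map omega^omega -> omega^omega given as its graph) realizes
   the multi-valued partial function f : X =>> Y. *)
Definition realizes {X Y : Type} (dX : baire -> X -> Prop) (dY : baire -> Y -> Prop)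
  (f : X -> Y -> Prop) (G : baire -> baire -> Prop) : Prop :=
  forall p x, dX p x -> (exists y, f x y) ->
    exists q, G p q /\ exists y, dY q y /\ f x y.

Definition bjoin (p q : baire) : baire :=
  fun n => if odd n then q n./2 else p n./2.

Definition weihrauch_le {X1 Y1 X2 Y2 : Type}
  (dX1 : baire -> X1 -> Prop) (dY1 : baire -> Y1 -> Prop) (f : X1 -> Y1 -> Prop)
  (dX2 : baire -> X2 -> Prop) (dY2 : baire -> Y2 -> Prop) (g : X2 -> Y2 -> Prop) : Prop :=
  exists ePhi ePsi : code,
    forall Gamma : baire -> option baire,
      realizes dX2 dY2 g (fun p q => Gamma p = Some q) ->
      realizes dX1 dY1 f
        (fun p s => exists q r, TF ePhi p q /\ Gamma q = Some r /\ TF ePsi (bjoin p r) s).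

Definition weihrauch_equiv {X1 Y1 X2 Y2 : Type}
  (dX1 : baire -> X1 -> Prop) (dY1 : baire -> Y1 -> Prop) (f : X1 -> Y1 -> Prop)
  (dX2 : baire -> X2 -> Prop) (dY2 : baire -> Y2 -> Prop) (g : X2 -> Y2 -> Prop) : Prop :=
  weihrauch_le dX1 dY1 f dX2 dY2 g /\ weihrauch_le dX2 dY2 g dX1 dY1 f.

Definition LAY (U : nat -> cantor -> Prop) (X : cantor) (i : nat) : Prop :=
  MLR X /\ ~ U i X.

Definition RD (U : nat -> cantor -> Prop) (X : cantor) (i : nat) : Prop :=
  MLR X /\ ~ U i X /\ (forall j, j < i -> U j X).

(* Main.v *)
Require Import Defs.
From mathcomp Require Import all_boot.
From mathcomp Require Import zify.
From Stdlib Require Import Classical.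
Set Implicit Arguments. Unset Strict Implicit. Unset Printing Implicit Defensive.

(* Enumerating V gives approximations r_n(X) of rd_V(X), computable from X, that
   settle after finitely many steps.  Compute Y from X by copying X(n) at place n,
   except that a 0 is written as long as some i < n has r_i(X) <> r_n(X) while Y|n
   has not been seen to enter U_i.  A sequence that ends in zeros is not random,
   hence lies in every U_i, so from some place on Y copies X and is random; and Y
   lies in every U_i with r_i(X) <> rd_V(X).  Thus any layer i of Y gives
   rd_V(X) = r_i(X), that is RD_V <= LAY_U.  Conversely, LAY_U <= RD_U <= LAY_V <= RD_V. *)

(** * Computable functionals *)

(** The pairs with sum [d] occupy consecutive codes from [d * d.+1 %/ 2] on, and [unpair] walks this
    diagonal from [(d, 0)] to [(0, d)]. Entering diagonal [d.+1] is one step from the end of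
    diagonal [d], whence the nested induction. *)
Lemma unpair_diag d y : y <= d -> unpair ((d * d.+1) %/ 2 + y) = (d - y, y).
Proof.
elim: d y => [|d IHd]; first by case.
elim=> [_|y IHy le_yd].
  have -> : (d.+1 * d.+2) %/ 2 + 0 = ((d * d.+1) %/ 2 + d).+1.
    have -> : d.+1 * d.+2 = d.+1 * 2 + d * d.+1 by lia.
    by rewrite divnMDl //; lia.
  by rewrite /= IHd // subnn.
by rewrite addnS /= (IHy (ltnW le_yd)) subSn // -subSS.
Qed.

Lemma npairK x y : unpair (npair x y) = (x, y).
Proof. by rewrite /npair unpair_diag ?leq_addl // addnK. Qed.

Lemma npair_inj x y x' y' : npair x y = npair x' y' -> x = x' /\ y = y'.
Proof. by move=> e; have := npairK x y; rewrite e npairK => -[]. Qed.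

Lemma unpairK z : npair (unpair z).1 (unpair z).2 = z.
Proof.
elim: z => [|z] //=; case: (unpair z) => -[|x] y /= <-; last first.
  by rewrite /npair addSnnS -[RHS]addnS.
rewrite /npair !addn0 add0n.
have -> : y.+1 * y.+2 = y.+1 * 2 + y * y.+1 by lia.
by rewrite divnMDl //; lia.
Qed.

(** Only functionals total on every oracle are considered. Predicates enter through the coercion of
    booleans to [0] and [1]. *)
Definition computable (F : baire -> nat -> nat) : Prop :=
  exists c, forall o x, eval o c x (F o x).

Definition computable2 (F : baire -> nat -> nat -> nat) : Prop :=
  computable (fun o z => F o (unpair z).1 (unpair z).2).

Lemma computable_ext F F' :
  computable F -> (forall o x, F o x = F' o x) -> computable F'.
Proof. by case=> c hc e; exists c => o x; rewrite -e. Qed.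

Lemma computable_comp F G : computable F -> computable G ->
  computable (fun o x => F o (G o x)).
Proof.
by case=> c hc [d hd]; exists (CComp c d) => o x; apply: eComp (hd o x) _.
Qed.

Lemma computable_pair F G : computable F -> computable G ->
  computable (fun o x => npair (F o x) (G o x)).
Proof. by case=> c hc [d hd]; exists (CPair c d) => o x; apply: ePair. Qed.

Lemma computable_succ F : computable F -> computable (fun o x => (F o x).+1).
Proof. by case=> c hc; exists (CComp CSucc c) => o x; apply: eComp (eSucc _ _). Qed.

Lemma computable_fst F : computable F -> computable (fun o x => (unpair (F o x)).1).
Proof. by case=> c hc; exists (CComp CFst c) => o x; apply: eComp (eFst _ _). Qed.

Lemma computable_snd F : computable F -> computable (fun o x => (unpair (F o x)).2).
Proof. by case=> c hc; exists (CComp CSnd c) => o x; apply: eComp (eSnd _ _). Qed.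

Lemma computable_oracle F : computable F -> computable (fun o x => o (F o x)).
Proof. by case=> c hc; exists (CComp COrc c) => o x; apply: eComp (eOrc _ _). Qed.

Lemma computable_id : computable (fun _ x => x).
Proof. by exists CId => o x; apply: eId. Qed.

Lemma computable_const k : computable (fun _ _ => k).
Proof.
elim: k => [|k IH]; first by exists CZero => o x; apply: eZero.
exact: computable_succ.
Qed.

Lemma computable_app2 F A B : computable2 F -> computable A -> computable B ->
  computable (fun o x => F o (A o x) (B o x)).
Proof.
move=> cF cA cB.
apply: computable_ext (computable_comp cF (computable_pair cA cB)) _ => o x.
by rewrite npairK.
Qed.

(** The one use of [CRec]: later functions are brought into the form of an [iteri], so that no
    further codes for recursion need be written. The step reads the argument, the counter and the
    accumulator from one coded triple. *)
Lemma computable_iteri (S : baire -> nat -> nat -> nat -> nat) A N :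
  computable (fun o z => S o (unpair z).1 (unpair (unpair z).2).1
                                          (unpair (unpair z).2).2) ->
  computable A -> computable N ->
  computable (fun o x => iteri (N o x) (S o x) (A o x)).
Proof.
move=> [c hc] [a ha] [n hn]; exists (CComp (CRec a c) (CPair CId n)) => o x.
apply: eComp (ePair (eId _ _) (hn o x)) _.
elim: (N o x) => [|k IH] /=; first exact: eRec0.
by apply: eRecS IH _; have := hc o (npair x (npair k (iteri k (S o x) (A o x))));
   rewrite !npairK.
Qed.

Ltac computability :=
  rewrite /computable2 /=;
  repeat first
    [ apply: computable_id | apply: computable_const | assumption
    | apply: computable_fst | apply: computable_snd | apply: computable_pair
    | apply: computable_succ ].

Lemma computable_pred F : computable F -> computable (fun o x => (F o x).-1).
Proof.
(* The iteration returns the last counter value, and the start value [0] settles the case of no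
   step. *)
move=> cF; apply: (@computable_ext (fun o x => iteri (F o x) (fun k _ => k) 0)).
  by apply: (@computable_iteri (fun _ _ k _ => k)); computability.
by move=> o x; case: (F o x).
Qed.

Lemma computable_add F G : computable F -> computable G ->
  computable (fun o x => F o x + G o x).
Proof.
move=> cF cG; apply: (@computable_ext (fun o x => iteri (G o x) (fun _ y => y.+1) (F o x))).
  by apply: (@computable_iteri (fun _ _ _ y => y.+1)); computability.
by move=> o x; elim: (G o x) => [|k /= ->]; rewrite ?addn0 ?addnS.
Qed.

Lemma computable_sub F G : computable F -> computable G ->
  computable (fun o x => F o x - G o x).
Proof.
move=> cF cG; apply: (@computable_ext (fun o x => iteri (G o x) (fun _ y => y.-1) (F o x))).
  apply: (@computable_iteri (fun _ _ _ y => y.-1)); computability.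
  by apply: computable_pred; computability.
by move=> o x; elim: (G o x) => [|k /= ->]; rewrite ?subn0 ?subnS.
Qed.

Lemma computable_mul F G : computable F -> computable G ->
  computable (fun o x => F o x * G o x).
Proof.
move=> cF cG; apply: (@computable_ext (fun o x => iteri (G o x) (fun _ y => y + F o x) 0)).
  apply: (@computable_iteri (fun o x _ y => y + F o x)); computability.
  apply: computable_add; computability.
  by apply: computable_comp => //; computability.
by move=> o x; elim: (G o x) => [|k /= ->]; rewrite ?muln0 // mulnS addnC.
Qed.

Lemma computable_if F G (B : baire -> nat -> bool) :
  computable F -> computable G -> computable (fun o x => B o x) ->
  computable (fun o x => if B o x then F o x else G o x).
Proof.
move=> cF cG cB.
(* The boolean serves as the number of iterations, so the start value is overwritten exactly when it
   is true. *)
apply: (@computable_ext (fun o x => iteri (B o x) (fun _ _ => F o x) (G o x))).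
  apply: (@computable_iteri (fun o x _ _ => F o x)); computability.
  by apply: computable_comp => //; computability.
by move=> o x; case: (B o x).
Qed.

Lemma computable_neg (B : baire -> nat -> bool) :
  computable (fun o x => B o x) -> computable (fun o x => ~~ B o x).
Proof.
move=> cB; apply: (@computable_ext (fun o x => 1 - B o x)).
  by apply: computable_sub; computability.
by move=> o x; case: (B o x).
Qed.

Lemma computable_and (B C : baire -> nat -> bool) :
  computable (fun o x => B o x) -> computable (fun o x => C o x) ->
  computable (fun o x => B o x && C o x).
Proof.
move=> cB cC; apply: (@computable_ext (fun o x => B o x * C o x)); first by apply: computable_mul.
by move=> o x; rewrite mulnb.
Qed.

Lemma computable_leq F G : computable F -> computable G ->
  computable (fun o x => F o x <= G o x).
Proof.
move=> cF cG; apply: (@computable_ext (fun o x => 1 - (F o x - G o x))).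
  by apply: computable_sub; computability; apply: computable_sub.
by move=> o x; rewrite /leq; case: (F o x - G o x).
Qed.

Lemma computable_eq F G : computable F -> computable G ->
  computable (fun o x => F o x == G o x).
Proof.
move=> cF cG; apply: (@computable_ext (fun o x => (F o x <= G o x) && (G o x <= F o x))).
  by apply: computable_and; apply: computable_leq.
by move=> o x; rewrite eqn_leq.
Qed.

Lemma computable_or (B C : baire -> nat -> bool) :
  computable (fun o x => B o x) -> computable (fun o x => C o x) ->
  computable (fun o x => B o x || C o x).
Proof.
move=> cB cC; apply: (@computable_ext (fun o x => ~~ (~~ B o x && ~~ C o x))).
  by apply: computable_neg; apply: computable_and; apply: computable_neg.
by move=> o x; rewrite negb_and !negbK.
Qed.

Lemma computable_odd F : computable F -> computable (fun o x => odd (F o x)).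
Proof.
move=> cF; apply: (@computable_ext (fun o x => iteri (F o x) (fun _ y => 1 - y) 0)).
  apply: (@computable_iteri (fun _ _ _ y => 1 - y)); computability.
  by apply: computable_sub; computability.
by move=> o x; elim: (F o x) => [|k /= ->] //; case: (odd k).
Qed.

Lemma computable_half F : computable F -> computable (fun o x => (F o x)./2).
Proof.
move=> cF; apply: (@computable_ext (fun o x => iteri (F o x) (fun k y => y + odd k) 0)).
  apply: (@computable_iteri (fun _ _ k y => y + odd k)); computability.
  by apply: computable_add; computability; apply: computable_odd; computability.
by move=> o x; elim: (F o x) => [|k /= ->] //; rewrite uphalf_half addnC.
Qed.

Lemma computable_exp2 F : computable F -> computable (fun o x => 2 ^ F o x).
Proof.
move=> cF; apply: (@computable_ext (fun o x => iteri (F o x) (fun _ y => y + y) 1)).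
  apply: (@computable_iteri (fun _ _ _ y => y + y)); computability.
  by apply: computable_add; computability.
by move=> o x; elim: (F o x) => [|k /= ->] //; rewrite expnS mul2n addnn.
Qed.

Lemma computable_has (B : baire -> nat -> nat -> bool) N :
  computable2 (fun o x k => B o x k) -> computable N ->
  computable (fun o x => has (B o x) (iota 0 (N o x))).
Proof.
move=> cB cN.
apply: (@computable_ext
  (fun o x => iteri (N o x) (fun k y => (y != 0) || B o x k) 0)).
  apply: (@computable_iteri (fun o x k y => (y != 0) || B o x k)); computability.
  apply: computable_or.
    by apply: computable_neg; apply: computable_eq; computability.
  by apply: (computable_app2 cB); computability.
move=> o x; elim: (N o x) => [|k IH] //.
by rewrite -[in RHS]addn1 iotaD has_cat [LHS]/= IH /= orbF; case: has.
Qed.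

Lemma computable_all (B : baire -> nat -> nat -> bool) N :
  computable2 (fun o x k => B o x k) -> computable N ->
  computable (fun o x => all (B o x) (iota 0 (N o x))).
Proof.
move=> cB cN.
apply: (@computable_ext (fun o x => ~~ has (fun k => ~~ B o x k) (iota 0 (N o x)))).
  apply: computable_neg; apply: (@computable_has (fun o x k => ~~ B o x k)) => //.
  exact: computable_neg.
by move=> o x; rewrite -all_predC; congr (nat_of_bool _); apply: eq_all => k /=; rewrite negbK.
Qed.

(** * Stagewise evaluation *)

(* [E s x] is [y.+1] when the computation of [e] on [x] returns [y] within [s]
   steps, and [0] otherwise. *)
Definition stage_evaluator (e : code) (E : nat -> nat -> nat) : Prop :=
  [/\ computable2 (fun _ => E),
      forall s t x y, s <= t -> E s x = y.+1 -> E t x = y.+1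
    & forall x y, eval (fun _ => 0) e x y <-> exists s, E s x = y.+1].

Lemma stage_evaluator_total e (f : nat -> nat) : computable (fun _ => f) ->
  (forall x y, eval (fun _ => 0) e x y <-> y = f x) ->
  stage_evaluator e (fun _ x => (f x).+1).
Proof.
move=> cf he; split=> //.
  by apply: computable_succ; apply: computable_comp cf _; computability.
move=> x y; rewrite he; split=> [->|[_ [->]] //]; by exists 0.
Qed.

Lemma stage_evaluator_comp f g F G : stage_evaluator f F -> stage_evaluator g G ->
  stage_evaluator (CComp f g) (fun s x => if G s x == 0 then 0 else F s (G s x).-1).
Proof.
move=> [cF mF eF] [cG mG eG]; split.
- apply: (@computable_if _ _ (fun _ z => G (unpair z).1 (unpair z).2 == 0)); computability.
    apply: (computable_app2 cF); computability.
    by apply: computable_pred; apply: cG.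
  by apply: computable_eq; computability; apply: cG.
- move=> s t x y le_st; case Gx: (G s x) => [|z] //= Fz.
  by rewrite (mG _ _ _ _ le_st Gx) /= (mF _ _ _ _ le_st Fz).
- move=> x y; split=> [h|[s]].
    inversion h as [| | | | | |? ? ? z ? hg hf| | | |]; subst.
    have [s Gs] := (eG _ _).1 hg; have [t Ft] := (eF _ _).1 hf.
    exists (maxn s t).
    by rewrite (mG _ _ _ _ (leq_maxl s t) Gs) /= (mF _ _ _ _ (leq_maxr s t) Ft).
  case Gx: (G s x) => [|z] //= Fz.
  by apply: (@eComp _ _ _ _ z); [apply/eG | apply/eF]; exists s.
Qed.

Lemma stage_evaluator_pair f g F G : stage_evaluator f F -> stage_evaluator g G ->
  stage_evaluator (CPair f g)
    (fun s x => if (F s x == 0) || (G s x == 0) then 0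
                else (npair (F s x).-1 (G s x).-1).+1).
Proof.
move=> [cF mF eF] [cG mG eG]; split.
- apply: (@computable_if _ _ (fun _ z =>
    (F (unpair z).1 (unpair z).2 == 0) || (G (unpair z).1 (unpair z).2 == 0))); computability.
  + by apply: computable_pred; apply: cF.
  + by apply: computable_pred; apply: cG.
  by apply: computable_or; apply: computable_eq; computability.
- move=> s t x y le_st; case Fx: (F s x) => [|u] //=; case Gx: (G s x) => [|v] //= <-.
  by rewrite (mF _ _ _ _ le_st Fx) (mG _ _ _ _ le_st Gx).
- move=> x y; split=> [h|[s]].
    inversion h as [| | | | | | |? ? ? u v hf hg| | |]; subst.
    have [s Fs] := (eF _ _).1 hf; have [t Gt] := (eG _ _).1 hg.
    exists (maxn s t).
    by rewrite (mG _ _ _ _ (leq_maxr s t) Gt) /= (mF _ _ _ _ (leq_maxl s t) Fs).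
  case Fx: (F s x) => [|u] //=; case Gx: (G s x) => [|v] //= [<-].
  by apply: ePair; [apply/eF | apply/eG]; exists s.
Qed.

(** The argument is hidden under [npair], which is not a constructor; it is generalized first and
    recovered by injectivity of pairing. *)
Lemma eval_rec_inv o f g x n y : eval o (CRec f g) (npair x n) y ->
  if n is m.+1 then
    exists2 u, eval o (CRec f g) (npair x m) u & eval o g (npair x (npair m u)) y
  else eval o f x y.
Proof.
move ec: (CRec f g) => c; move ez: (npair x n) => z h; case: h ec ez => //.
  by move=> f' g' x' y' h [-> ->] /npair_inj[-> ->].
move=> f' g' x' m u y' h1 h2 [ef eg] /npair_inj[-> ->]; exists u => //.
by rewrite eg.
Qed.

(** The whole recursion is run with the single stage bound [s], and a failure [0] at any level is
    passed on to the end. *)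
Lemma stage_evaluator_rec f g F G : stage_evaluator f F -> stage_evaluator g G ->
  exists E, stage_evaluator (CRec f g) E.
Proof.
move=> [cF mF eF] [cG mG eG].
pose step s x k y := if y == 0 then 0 else G s (npair x (npair k y.-1)).
pose E s z := iteri (unpair z).2 (step s (unpair z).1) (F s (unpair z).1).
have mE s t x n y : s <= t -> iteri n (step s x) (F s x) = y.+1 ->
    iteri n (step t x) (F t x) = y.+1.
  move=> le_st; elim: n y => [|n IH] y /=; first exact: mF.
  case Ey: (iteri n _ _) => [|u] //; rewrite (IH _ Ey) /step /=; exact: mG.
exists E; split.
- apply: (@computable_iteri (fun _ z => step (unpair z).1 (unpair (unpair z).2).1)).
  + apply: (@computable_if _ _ (fun _ z => (unpair (unpair z).2).2 == 0)); computability.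
      apply: (computable_app2 cG); computability.
      by apply: computable_pred; computability.
    by apply: computable_eq; computability.
  + by apply: (computable_app2 cF); computability.
  + by computability.
- by move=> s t z y; apply: mE.
- move=> z y; split=> [h|[s]].
    move: h; rewrite -{1}[z]unpairK /E; move: (unpair z).1 (unpair z).2 => x n.
    elim: n y => [|n IH] y /eval_rec_inv /=; first by move/eF.
    case=> u /IH[s Es] /eG[t Gt]; exists (maxn s t).
    by rewrite (mE _ _ _ _ _ (leq_maxl s t) Es) /step /= (mG _ _ _ _ (leq_maxr s t) Gt).
  rewrite -{2}[z]unpairK /E.
  elim: (unpair z).2 y => [|n IH] y /=.
    by move=> Fy; apply: eRec0; apply/eF; exists s.
  case Ey: (iteri n _ _) => [|u] //; rewrite /step /= => Gy.
  by apply: eRecS (IH _ Ey) _; apply/eG; exists s.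
Qed.

Lemma stage_evaluator_mu f F : stage_evaluator f F ->
  exists E, stage_evaluator (CMu f) E.
Proof.
move=> [cF mF eF].
(* Under the shift by one, [1] codes the value 0 and anything larger codes a positive value. Thus
   [found s x k] says that stage [s] already certifies [k] as the result of the search. *)
pose found s x k := (F s (npair x k) == 1) && all (fun m => 1 < F s (npair x m)) (iota 0 k).
pose E s x := iteri s (fun k y => if y == 0 then (if found s x k then k.+1 else 0) else y) 0.
(* Of two certified candidates the smaller would have both a zero and a positive value. Hence the
   scan below [s] records the only possible answer. *)
have found_uniq s x m n : found s x m -> found s x n -> m = n.
  move=> /andP[/eqP Fm /allP am] /andP[/eqP Fn /allP an].
  case: (ltngtP m n) => // lt; [have := an m | have := am n];
    by rewrite mem_iota lt ?Fm ?Fn => /(_ isT).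
have E_found s x y : E s x = y.+1 <-> y < s /\ found s x y.
  rewrite /E; elim: {1 3}s y => [|k IH] y; first by split=> // -[].
  rewrite /=; move: IH; case: (iteri k _ 0) => [|w] IH /=; last first.
    have [lt_wk fw] := (IH w).1 erefl.
    split=> [[<-]|[_ fy]]; last by rewrite (found_uniq _ _ _ _ fy fw).
    by rewrite leqW.
  case: ifP => [fk|nfk].
    split=> [[<-]|[_ fy]]; last by rewrite (found_uniq _ _ _ _ fy fk).
    by rewrite leqnn.
  split=> // -[]; rewrite ltnS leq_eqVlt => /orP[/eqP->|lt_yk fy].
    by rewrite nfk.
  by have := (IH y).2 (conj lt_yk fy).
  have mfound s t x k : s <= t -> found s x k -> found t x k.
  move=> le_st /andP[/eqP Fk /allP ak]; apply/andP; split.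
    by rewrite (mF _ _ _ _ le_st Fk).
  apply/allP => m /ak; case Fm: (F s _) => [|[|u]] // _.
  by rewrite (mF _ _ _ _ le_st Fm).
exists E; split.
- apply: (@computable_iteri (fun _ z k y =>
    if y == 0 then (if found (unpair z).1 (unpair z).2 k then k.+1 else 0) else y)).
  + apply: (@computable_if _ _ (fun _ z => (unpair (unpair z).2).2 == 0)); computability.
      apply: (@computable_if _ _ (fun _ z => found (unpair (unpair z).1).1
         (unpair (unpair z).1).2 (unpair (unpair z).2).1)); computability.
      apply: computable_and.
        by apply: computable_eq; computability; apply: (computable_app2 cF); computability.
      apply: (@computable_all (fun _ z m => 
         1 < F (unpair (unpair z).1).1 (npair (unpair (unpair z).1).2 m))); computability.
      apply: computable_leq; computability.
      by apply: (computable_app2 cF); computability.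
    by apply: computable_eq; computability.
  + by computability.
  + by computability.
- move=> s t x y le_st /E_found[lt_ys fy]; apply/E_found; split.
    exact: leq_trans le_st.
  exact: mfound fy.
- move=> x y; split=> [h|[s /E_found[lt_ys /andP[/eqP Fy /allP ay]]]]; last first.
    apply: eMu => [|m lt_my]; first by apply/eF; exists s.
    have := ay m; rewrite mem_iota lt_my => /(_ isT).
    by case Fm: (F s _) => [|[|k]] // _; exists k; apply/eF; exists s.
  have [hy hlt] : eval (fun _ => 0) f (npair x y) 0 /\
      forall m, m < y -> exists k, eval (fun _ => 0) f (npair x m) k.+1.
    by inversion h.
  have [s Fy] := (eF _ _).1 hy.
  (* Each of the finitely many values below [y] appears at some stage; monotonicity lets a maximum
     serve them all. *)
  have [t Ft] : exists t, all (fun m => 1 < F t (npair x m)) (iota 0 y).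
    elim: {h hy Fy} y hlt => [|y IH] hlt; first by exists 0.
    have [m lt_my|t /allP ht] := IH; first exact/hlt/leqW.
    have [k /eF[u Fu]] := hlt y (leqnn _); exists (maxn t u).
    rewrite -[y.+1]addn1 iotaD all_cat add0n /= (mF _ _ _ _ (leq_maxr t u) Fu) /= andbT.
    apply/allP => m /ht; case Fm: (F t _) => [|[|v]] // _.
    by rewrite (mF _ _ _ _ (leq_maxl t u) Fm).
  exists (maxn y.+1 (maxn s t)); apply/E_found; rewrite leq_maxl; split=> //.
  apply/andP; split.
    by rewrite (mF s _ _ _ _ Fy) // !leq_max leqnn !orbT.
  apply/allP => m hm; have := allP Ft m hm; case Fm: (F t _) => [|[|v]] // _.
  by rewrite (mF t _ _ _ _ Fm) // !leq_max leqnn !orbT.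
Qed.

Lemma stage_evaluator_exists e : exists E, stage_evaluator e E.
Proof.
elim: e => [||||||f [F hF] g [G hG]|f [F hF] g [G hG]|f [F hF] g [G hG]|f [F hF]].
- exists (fun _ _ => 1); apply: (@stage_evaluator_total _ (fun _ => 0)).
    exact: computable_const.
  by move=> x y; split=> [h|->]; [inversion h | apply: eZero].
- exists (fun _ x => x.+2); apply: (@stage_evaluator_total _ (fun x => x.+1)).
    by computability.
  by move=> x y; split=> [h|->]; [inversion h | apply: eSucc].
- exists (fun _ x => x.+1); apply: (@stage_evaluator_total _ (fun x => x)).
    by computability.
  by move=> x y; split=> [h|->]; [inversion h | apply: eId].
- exists (fun _ x => (unpair x).1.+1); apply: (@stage_evaluator_total _ (fun x => (unpair x).1)).
    by computability.
  by move=> x y; split=> [h|->]; [inversion h | apply: eFst].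
- exists (fun _ x => (unpair x).2.+1); apply: (@stage_evaluator_total _ (fun x => (unpair x).2)).
    by computability.
  by move=> x y; split=> [h|->]; [inversion h | apply: eSnd].
- exists (fun _ _ => 1); apply: (@stage_evaluator_total _ (fun _ => 0)).
    exact: computable_const.
  move=> x y; split=> [h|->]; [by inversion h | exact: (@eOrc (fun _ => 0))].
- by exists (fun s x => if G s x == 0 then 0 else F s (G s x).-1); apply: stage_evaluator_comp.
- by eexists; apply: stage_evaluator_pair hF hG.
- exact: stage_evaluator_rec hF hG.
- exact: stage_evaluator_mu hF.
Qed.

(** Both results are read off the stage evaluator, a function, at a common later stage. *)
Lemma eval_det e x y z : eval (fun _ => 0) e x y -> eval (fun _ => 0) e x z -> y = z.
Proof.
have [E [_ mE eE]] := stage_evaluator_exists e.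
move=> /eE[s Es] /eE[t Et]; apply: succn_inj.
by rewrite -(mE _ _ _ _ (leq_maxl s t) Es) (mE _ _ _ _ (leq_maxr s t) Et).
Qed.

Lemma halts_stages e : exists T : nat -> nat -> bool,
  [/\ computable2 (fun _ n s => T n s),
      forall n s t, s <= t -> T n s -> T n t
    & forall n, halts e n <-> exists s, T n s].
Proof.
have [E [cE mE eE]] := stage_evaluator_exists e.
exists (fun n s => 0 < E s n); split.
- by apply: computable_leq; computability; apply: (computable_app2 cE); computability.
- by move=> n s t le_st; case Es: (E s n) => [|y] // _; rewrite (mE _ _ _ _ le_st Es).
- move=> n; split=> [[y /eE[s Es]]|[s]]; first by exists s; rewrite Es.
  by case Es: (E s n) => [|y] // _; exists y; apply/eE; exists s.
Qed.

(** Closure of c.e. sets under computable preimages; it supplies the enumerations of the tests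
    obtained from a given test below. *)
Lemma halts_preimage e f : computable (fun _ => f) ->
  exists e', forall n, halts e' n <-> halts e (f n).
Proof.
case=> c hc; exists (CComp e c) => n; split=> [[y h]|[y h]].
  inversion h as [| | | | | |? ? ? z ? hz hy| | | |]; subst; exists y.
  by rewrite -(eval_det hz (hc _ n)).
by exists y; apply: eComp (hc _ n) h.
Qed.

(** The search looks for a zero of a function that ignores the search variable: it stops at once if
    [B n] holds and never otherwise. *)
Lemma halts_decidable (B : nat -> bool) : computable (fun _ n => B n) ->
  exists e, forall n, halts e n <-> B n.
Proof.
move=> cB; have [c hc] : computable (fun _ z => ~~ B (unpair z).1).
  by apply: computable_neg; apply: computable_comp cB _; computability.
have {}hc o n m : eval o c (npair n m) (~~ B n) by have := hc o (npair n m); rewrite npairK.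
exists (CMu c) => n; split=> [[y h]|Bn]; last first.
  by exists 0; apply: eMu => //; have := hc (fun _ => 0) n 0; rewrite Bn.
have h0 : eval (fun _ => 0) c (npair n y) 0 by inversion h.
by have := eval_det h0 (hc _ n y); case: (B n).
Qed.

(** * Closure properties of Martin-Löf randomness *)

(** [scode] is bijective base 2 with digits 1 and 2, least significant first. Appending a bit thus
    adds one term, so codes of prefixes can be built by iteration. *)
Lemma scode_rcons s b : scode (rcons s b) = scode s + 2 ^ size s * b.+1.
Proof. by elim: s => [|a s IH] /=; rewrite ?expnS ?IH; lia. Qed.

Lemma scode_behead s : scode (behead s) = (scode s).-1./2.
Proof. by case: s => [|b s] //=; case: b; lia. Qed.

Definition code_tail c := c.-1./2.

(** The leading digit [1 + b] makes the code odd exactly when [b] is false. Past the end the code is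
    [0], which is even, so missing bits read as [true]. *)
Definition code_bit c k : bool := ~~ odd (iter k code_tail c).

Lemma code_bitE s k : code_bit (scode s) k = nth true s k.
Proof.
rewrite /code_bit; have -> : iter k code_tail (scode s) = scode (drop k s).
  elim: k => [|k IH] /=; first by rewrite drop0.
  by rewrite IH /code_tail -scode_behead -drop1 drop_drop add1n.
elim: s k => [|b s IH] [|k] //=.
by case: b; lia.
Qed.

Lemma computable_code_bit C K : computable C -> computable K ->
  computable (fun o x => code_bit (C o x) (K o x)).
Proof.
move=> cC cK; apply: computable_neg; apply: computable_odd.
apply: (@computable_ext (fun o x => iteri (K o x) (fun _ => code_tail) (C o x))).
  apply: (@computable_iteri (fun _ _ _ => code_tail)) => //.
  by apply: computable_half; apply: computable_pred; computability.
by move=> o x; elim: (K o x) => //= k ->.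
Qed.

Definition scons b (X : cantor) : cantor := fun n => if n is m.+1 then X m else b.
Definition shift (X : cantor) : cantor := fun n => X n.+1.

Lemma mkseq_scons b X n : mkseq (scons b X) n.+1 = b :: mkseq X n.
Proof. by rewrite /mkseq /= (iotaDl 1 0) -map_comp. Qed.

Lemma cyl_scons b s X : cyl (b :: s) (scons b X) <-> cyl s X.
Proof. by rewrite /cyl mkseq_scons; split=> [[]|->]. Qed.

Lemma scons_shift X : X =1 scons (X 0) (shift X).
Proof. by case. Qed.

Lemma cylP s X : cyl s X <-> forall k, k < size s -> X k = nth true s k.
Proof.
split=> [<- k|h]; first by rewrite size_mkseq => lt_k; rewrite nth_mkseq.
apply: (@eq_from_nth _ true); rewrite size_mkseq // => k lt_k.
by rewrite nth_mkseq // h.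
Qed.

Lemma cyl_mkseq X n : cyl (mkseq X n) X.
Proof. by rewrite /cyl size_mkseq. Qed.

Lemma cyl_shift s X : cyl s X -> cyl (behead s) (shift X).
Proof.
case: s => [|b s] // /cylP h; apply/cylP => k lt_k; exact: (h k.+1).
Qed.

(** Membership in an open set is decided by a finite prefix, so pointwise equality suffices and
    functional extensionality is avoided. *)
Lemma open_ext V X Y : is_open V -> X =1 Y -> V X -> V Y.
Proof.
move=> oV eXY /oV[n]; apply; rewrite (eq_mkseq eXY); exact: cyl_mkseq.
Qed.

Lemma MLR_ext X Y : X =1 Y -> MLR X -> MLR Y.
Proof.
move=> eXY rX W tW; have [i nWX] := rX W tW; exists i => WY; apply: nWX.
case: tW => oW _ _; apply: open_ext WY => //; exact: fsym.
Qed.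

Lemma count_strings_cons a N : count a (strings N.+1) =
  count (fun t => a (false :: t)) (strings N) + count (fun t => a (true :: t)) (strings N).
Proof. by rewrite /strings -/(strings N) /= cats0 count_cat !count_map. Qed.

Lemma size_strings N : size (strings N) = 2 ^ N.
Proof.
by elim: N => // N IH; rewrite -count_predT count_strings_cons !count_predT IH expnS mul2n addnn.
Qed.

(** Taking the preimage under prepending a bit at most doubles the measure; the index [i.+1] pays
    for this factor. *)
Lemma ML_test_scons b W : ML_test W -> ML_test (fun i X => W i.+1 (scons b X)).
Proof.
case=> oW [e he] mW.
have subE i s : Defs.subset (cyl s) (fun X => W i.+1 (scons b X)) <->
    Defs.subset (cyl (b :: s)) (W i.+1).
  split=> sub X; last by move=> sX; apply: sub; apply/cyl_scons.
  move=> bsX; have X0 : X 0 = b by have /cylP := bsX; apply.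
  apply: (open_ext (oW _) _ (sub (shift X) (cyl_shift bsX))).
  by rewrite -X0; apply: fsym; apply: scons_shift.
split.
- move=> i X /(oW _)[n sub]; exists n; apply/subE => Y; rewrite -mkseq_scons => h.
  by apply: sub; move: h => /cylP h; apply/cylP => k; rewrite size_mkseq => lt_k;
    rewrite h ?size_mkseq ?leqW // !nth_mkseq // leqW.
- have [e' he'] : exists e', forall n, halts e' n <->
      halts e (npair (unpair n).1.+1 (((unpair n).2 + (unpair n).2).+1 + b)).
    apply: (@halts_preimage e
      (fun n => npair (unpair n).1.+1 (((unpair n).2 + (unpair n).2).+1 + b))).
    computability; apply: computable_add; computability.
    by apply: computable_add; computability.
  exists e' => i s; rewrite subE he he' npairK /=.
  by rewrite addnn addn1.
- move=> i F N subF sizeF.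
  (* Doubling both sides turns the claim at length [N] into the bound for [W i.+1] at length [N.+1],
     of which only strings beginning with [b] are used. *)
  rewrite -(leq_pmul2l (isT : 0 < 2)) mulnCA -!expnS.
  apply: leq_trans (mW i.+1 [seq b :: s | s <- F] N.+1 _ _).
  + rewrite leq_mul2r count_strings_cons; apply/orP; right.
    rewrite [leqLHS](@eq_count _ _ (fun t => has (fun s => prefix s (b :: t)) [seq b :: s | s <- F])).
      by case: (b); [apply: leq_addl | apply: leq_addr].
    by move=> t; rewrite has_map; apply: eq_has => s /=; rewrite eqxx.
  + by move=> _ /mapP[s sF ->]; apply/subE; apply: subF.
  + by move=> _ /mapP[s /sizeF sF ->].
Qed.

(** The shift preserves measure, so the index stays the same: each string of length [N] has just two
    extensions by a first bit. *)
Lemma ML_test_shift W : ML_test W -> ML_test (fun i X => W i (shift X)).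
Proof.
case=> oW [e he] mW.
have subE i s : Defs.subset (cyl s) (fun X => W i (shift X)) <-> Defs.subset (cyl (behead s)) (W i).
  split=> sub X sX; last by apply: sub; apply: cyl_shift.
  apply: (sub (scons (head true s) X)).
  by case: s sX {sub} => // b s sX; apply/cyl_scons.
split.
- move=> i X /(oW _)[n sub]; exists n.+1; apply/subE.
  by rewrite (eq_mkseq (scons_shift X)) mkseq_scons.
- have [|e' he'] :=
      @halts_preimage e (fun n => npair (unpair n).1 (code_tail (unpair n).2)).
    by computability; apply: computable_half; apply: computable_pred; computability.
  by exists e' => i s; rewrite subE he he' npairK /= scode_behead.
(* At length 0 there is no first bit to drop: [F] contains only empty strings, and the bound for
   [W i] applies directly. *)
- move=> i F [|N] subF sizeF.
    apply: mW => // s sF; have := subF s sF; rewrite subE.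
    by have := sizeF s sF; case: (s).
  have := mW i [seq behead s | s <- F] N.
  have le2 : count (fun t => has (fun s => prefix s t) F) (strings N.+1) <=
      2 * count (fun t => has (fun s => prefix s t) [seq behead s | s <- F]) (strings N).
    rewrite count_strings_cons mul2n -addnn; apply: leq_add; apply: sub_count => t /hasP[s sF];
      by move=> pre; apply/hasP; exists (behead s); rewrite ?map_f //;
         case: s pre {sF} => [_|b s /andP[]] //=; rewrite prefix0s.
  move=> h; rewrite expnS; apply: leq_trans (leq_mul le2 (leqnn _)) _.
  rewrite -mulnA leq_mul2l h //= => _ /mapP[s sF ->].
    by apply/subE; apply: subF.
  by rewrite size_behead -ltnS; have := sizeF s sF; case: (size s).
Qed.

(** Level [i] is the cylinder of the string of [i] zeros, so the test captures exactly the zero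
    sequence. *)
Definition zero_test i (X : cantor) := forall k, k < i -> X k = false.

Lemma count_zero_prefix i N : count (prefix (nseq i false)) (strings N) * 2 ^ i <= 2 ^ N.
Proof.
elim: i N => [|i IH] [|N] //.
- by rewrite muln1 -size_strings count_size.
- rewrite count_strings_cons /= [X in _ + X]count_pred0 addn0 !expnS mulnCA leq_mul2l.
  by rewrite IH.
Qed.

Lemma ML_test_zero : ML_test zero_test.
Proof.
(* The default [true] matters: the witness is [s] continued by ones, so a string shorter than [i]
   fails the condition. *)
have subE i s : Defs.subset (cyl s) (zero_test i) <-> forall k, k < i -> nth true s k = false.
  split=> sub.
    apply: sub; apply/cylP => //.
  move=> X /cylP sX k lt_ki; have := sub k lt_ki; rewrite -sX //.
  by rewrite ltnNge; apply/negP => le; have := sub k lt_ki; rewrite nth_default.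
split.
- move=> i X zX; exists i; apply/subE => k lt_ki; by rewrite nth_mkseq ?zX.
- have [|e he] := @halts_decidable
      (fun n => all (fun k => ~~ code_bit (unpair n).2 k) (iota 0 (unpair n).1)).
    apply: (@computable_all (fun _ n k => ~~ code_bit (unpair n).2 k)); computability.
    by apply: computable_neg; apply: computable_code_bit; computability.
  exists e => i s; rewrite subE he npairK /=; split=> [z|/allP z k lt_ki].
    by apply/allP => k; rewrite mem_iota code_bitE => /z ->.
  by have := z k; rewrite mem_iota code_bitE => /(_ lt_ki)/negbTE.
- move=> i F N subF _; apply: leq_trans (count_zero_prefix i N); rewrite leq_mul2r.
  apply/orP; right; apply: sub_count => t /hasP[s /subF/subE z]; apply: prefix_trans.
  have le_is : i <= size s.
    by rewrite leqNgt; apply/negP => /z; rewrite nth_default.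
  rewrite prefixE size_nseq; apply/eqP; apply: (@eq_from_nth _ true).
    by rewrite size_nseq size_takel.
  by move=> k; rewrite size_takel // => lt_ki; rewrite nth_take // nth_nseq lt_ki z.
Qed.

Lemma MLR_scons b X : MLR X -> MLR (scons b X).
Proof. by move=> rX W /(ML_test_scons b)/rX[i nW]; exists i.+1. Qed.

Lemma MLR_shift X : MLR X -> MLR (shift X).
Proof. by move=> rX W /ML_test_shift/rX. Qed.

(** The first [n] bits are removed by shifts and those of [Y] are put back one at a time; both
    operations preserve randomness. *)
Lemma MLR_tail_eq n X Y : (forall k, n <= k -> X k = Y k) -> MLR X -> MLR Y.
Proof.
elim: n X Y => [|n IH] X Y e rX; first by apply: MLR_ext rX => k; apply: e.
apply: (MLR_ext (fsym (scons_shift Y))); apply: MLR_scons.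
by apply: (IH (shift X)); [move=> k le_nk; apply: e | apply: MLR_shift].
Qed.

Lemma eventually_zero_not_MLR n X : (forall k, n <= k -> X k = false) -> ~ MLR X.
Proof.
move=> e rX; have /(_ _ ML_test_zero)[i] : MLR (fun _ => false).
  by apply: MLR_tail_eq rX => k /e.
by apply.
Qed.

Lemma universal_not_MLR U X : universal U -> ~ MLR X -> forall i, U i X.
Proof.
move=> [_ uU] nrX i; apply: NNPP => nUX; apply: nrX => W tW.
by apply: not_all_ex_not => WX; apply: nUX; apply: uU tW _ WX i.
Qed.

(** * Reducing the exact deficiency to a layer *)

Definition prefix_code (p : baire) n := iteri n (fun k c => c + 2 ^ k * (p k).+1) 0.

Lemma prefix_codeE (p : baire) (X : cantor) n :
  (forall k, k < n -> p k = X k) -> prefix_code p n = scode (mkseq X n).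
Proof.
elim: n => [|n IH] // pX; rewrite mkseqS scode_rcons size_mkseq -IH => [|k lt_kn].
  by rewrite -pX.
by apply: pX; apply: leqW.
Qed.

Lemma computable_prefix_code P N : computable2 P -> computable N ->
  computable (fun o x => prefix_code (P o x) (N o x)).
Proof.
move=> cP cN; apply: (@computable_iteri (fun o x k c => c + 2 ^ k * (P o x k).+1)); computability.
apply: computable_add; computability; apply: computable_mul.
  by apply: computable_exp2; computability.
by computability; apply: (computable_app2 cP); computability.
Qed.

(** Stage [n] of the event that [p] enters level [i]. Only prefixes of length below [n] are
    consulted, and this bound makes the recursion for [encode] well founded. *)
Definition seen (T : nat -> nat -> bool) (p : baire) i n :=
  has (fun l => T (npair i (prefix_code p l)) n) (iota 0 n).

Definition open_stages (V : nat -> cantor -> Prop) (T : nat -> nat -> bool) :=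
  [/\ computable2 (fun _ n s => T n s),
      forall p i m n, m <= n -> seen T p i m -> seen T p i n
    & forall (p : baire) (X : cantor) i, (forall k, p k = X k) ->
        V i X <-> exists n, seen T p i n].

Lemma ML_test_stages V : ML_test V -> exists T, open_stages V T.
Proof.
case=> oV [e he] _; have [T [cT mT eT]] := halts_stages e; exists T; split=> //.
  move=> p i m n le_mn /hasP[l]; rewrite mem_iota => lt_lm Tl.
  apply/hasP; exists l; first by rewrite mem_iota (leq_trans lt_lm).
  exact: mT le_mn Tl.
move=> p X i pX; split=> [/oV[l /he/eT[s Ts]]|[n /hasP[l _ Tl]]].
  (* The stage must exceed the length [l] of the witnessing prefix and reach the stage that
     enumerates its cylinder. *)
  exists (maxn l.+1 s); apply/hasP; exists l.
    by rewrite mem_iota leq_maxl.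
  by rewrite (@prefix_codeE p X) => [|k _]; [exact: mT (leq_maxr _ _) Ts | exact: pX].
have /he :  halts e (npair i (scode (mkseq X l))).
  by apply/eT; exists n; rewrite -(@prefix_codeE p X) // => k _; apply: pX.
by apply; apply: cyl_mkseq.
Qed.

Lemma eq_seen T p q i n : (forall k, k < n -> p k = q k) -> seen T p i n = seen T q i n.
Proof.
move=> pq; apply: eq_in_has => l; rewrite mem_iota => lt_ln.
congr (T (npair i _) n); rewrite /prefix_code.
elim: l lt_ln => //= l IH lt_ln; rewrite IH ?pq //; exact: ltnW.
Qed.

Lemma computable_seen (T : nat -> nat -> bool) P I N : computable2 (fun _ n s => T n s) ->
  computable2 P -> computable I -> computable N ->
  computable (fun o x => seen T (P o x) (I o x) (N o x)).
Proof.
move=> cT cP cI cN.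
apply: (@computable_has (fun o x l =>
  T (npair (I o x) (prefix_code (P o x) l)) (N o x))) => //.
apply: (computable_app2 cT); computability.
- by apply: computable_comp cI _; computability.
- apply: (@computable_prefix_code (fun o z => P o (unpair z).1)); computability.
  by apply: (computable_app2 cP); computability.
- by apply: computable_comp cN _; computability.
Qed.

(* The least [i] with [~ seen T p i n], or [n] if there is none below [n]. *)
Definition approx T (p : baire) n := iteri n (fun _ y => y + seen T p y n) 0.

(** Once all levels below [R] have been seen, the iteration climbs to [R] and stays there, because
    [R] is never seen. *)
Lemma approx_cvg T p R : (forall i m n, m <= n -> seen T p i m -> seen T p i n) ->
  (forall j, j < R -> exists n, seen T p j n) -> (forall n, ~~ seen T p R n) ->
  exists N, forall n, N <= n -> approx T p n = R.
Proof.
move=> mT sT nT.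
have [N hN] : exists N, forall j, j < R -> seen T p j N.
  elim: {nT} R sT => [|R IH] sT; first by exists 0.
  have [j lt_jR|N hN] := IH; first exact/sT/leqW.
  have [M hM] := sT R (leqnn _); exists (maxn N M) => j.
  rewrite ltnS leq_eqVlt => /orP[/eqP->|/hN].
    exact: mT (leq_maxr _ _) hM.
  exact/mT/leq_maxl.
(* Beyond [N] the levels below [R] are all seen; [n] must also be at least [R], since [approx] makes
   only [n] steps. *)
exists (maxn N R) => n; rewrite geq_max => /andP[le_Nn le_Rn].
have E k : iteri k (fun _ y => y + seen T p y n) 0 = minn k R.
  elim: k => [|k IH] /=; first by rewrite min0n.
  rewrite IH; case: (ltnP k R) => [lt_kR|le_Rk].
    by rewrite (mT _ _ _ le_Nn (hN _ lt_kR)); lia.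
  by rewrite (negbTE (nT n)); lia.
by rewrite /approx E (minn_idPr le_Rn).
Qed.

Lemma eq_approx T p q n : p =1 q -> approx T p n = approx T q n.
Proof. by move=> pq; apply: eq_iteri => _ y; rewrite (@eq_seen T p q). Qed.

Lemma computable_approx (T : nat -> nat -> bool) P N : computable2 (fun _ n s => T n s) ->
  computable2 P -> computable N ->
  computable (fun o x => approx T (P o x) (N o x)).
Proof.
move=> cT cP cN.
apply: (@computable_iteri (fun o x _ y => y + seen T (P o x) y (N o x))); computability.
apply: computable_add; computability.
apply: (@computable_seen _ (fun o z => P o (unpair z).1)); computability.
  by apply: (computable_app2 cP); computability.
by apply: computable_comp cN _; computability.
Qed.

(** * The random sequence that encodes the deficiency *)

Section Encoding.
Variables T S : nat -> nat -> bool.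

(** Here [q] is the output built so far: every earlier guess that differs from the current one must
    have been refuted by [q] entering the level with that index. *)
Definition settled p q n :=
  all (fun i => (approx T p i == approx T p n) || seen S q i n) (iota 0 n).

Definition encode_next p c n := settled p (code_bit c) n && (p n != 0).

(** Course-of-values recursion: the whole output so far is carried as one string code, which fits
    the form of [computable_iteri]. *)
Definition encode_history p n :=
  iteri n (fun k c => c + 2 ^ k * (encode_next p c k).+1) 0.

Definition encode p n : bool := encode_next p (encode_history p n) n.

Lemma encode_historyE p n : encode_history p n = scode (mkseq (encode p) n).
Proof.
elim: n => // n IH.
by rewrite mkseqS scode_rcons size_mkseq -IH.
Qed.

(** The coded history may be replaced by the full sequence because stage [n] reads only bits below
    [n]. *)
Lemma encodeE p n : encode p n = settled p (fun k => encode p k) n && (p n != 0).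
Proof.
rewrite {1}/encode /encode_next; congr (_ && _); apply: eq_all => i; congr (_ || _).
apply: eq_seen => k lt_kn; rewrite encode_historyE code_bitE nth_mkseq //.
Qed.

Hypotheses (cT : computable2 (fun _ n s => T n s)) (cS : computable2 (fun _ n s => S n s)).

Lemma computable_encode_next C N : computable C -> computable N ->
  computable (fun o x => encode_next o (C o x) (N o x)).
Proof.
move=> cC cN; apply: computable_and; last first.
  apply: computable_neg; apply: computable_eq; computability.
  exact: computable_oracle.
apply: (@computable_all (fun o x i => (approx T o i == approx T o (N o x)) ||
  seen S (code_bit (C o x)) i (N o x))) => //.
have cCz : computable (fun o z => C o (unpair z).1).
  by apply: computable_comp cC _; computability.
have cNz : computable (fun o z => N o (unpair z).1).
  by apply: computable_comp cN _; computability.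
apply: computable_or.
  by apply: computable_eq; apply: (@computable_approx _ (fun o _ => o)); computability;
     apply: computable_oracle; computability.
apply: (@computable_seen _ (fun o z => code_bit (C o (unpair z).1))); computability.
apply: computable_code_bit; computability.
by apply: (computable_comp cCz); computability.
Qed.

Lemma computable_encode : computable (fun o x => encode o x).
Proof.
apply: computable_encode_next; computability.
apply: (@computable_iteri (fun o _ k c => c + 2 ^ k * (encode_next o c k).+1)); computability.
apply: computable_add; computability; apply: computable_mul.
  by apply: computable_exp2; computability.
by computability; apply: computable_encode_next; computability.
Qed.
End Encoding.

Lemma encode_correct U V T S (p : baire) (X : cantor) R : universal U ->
  open_stages V T -> open_stages U S -> (forall k, p k = X k) -> RD V X R ->
  MLR (encode T S p) /\
  forall i, ~ U i (encode T S p) -> approx T p i = R.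
Proof.
move=> uU [cT mT eT] [cS mS eS] pX [rX [nVX VX]].
set Y := encode T S p; pose q : baire := fun k => Y k.
have [N hN] : exists N, forall n, N <= n -> approx T p n = R.
  apply: approx_cvg => [i m n|j /VX|n]; first exact: mT.
    by case/(eT _ _ _ pX) => n; exists n.
  by apply/negP => h; apply: nVX; apply/(eT _ _ _ pX); exists n.
(* From [N] on the current guess is always [R]. Guesses made after [N] agree with it, and a
   refutation of an older one persists. *)
have settled_mono m n : N <= m -> m <= n -> settled T S p q m -> settled T S p q n.
  move=> le_Nm le_mn /allP h; apply/allP => i; rewrite mem_iota => lt_in.
  rewrite (hN n (leq_trans le_Nm le_mn)).
  case: (leqP N i) => [/hN->|lt_iN]; first by rewrite eqxx.
  have := h i; rewrite mem_iota (hN m le_Nm) => /(_ (leq_trans lt_iN le_Nm)).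
  by case/orP => [->//|/(mS _ _ _ _ le_mn)->]; rewrite orbT.
(* Otherwise the output is zero from [N] on, hence lies in every level of [U]. Then all of the
   finitely many guesses before [N] get refuted, which settles a later stage after all. *)
have [m le_Nm sm] : exists2 m, N <= m & settled T S p q m.
  apply: NNPP => none.
  have Y0 k : N <= k -> Y k = false.
    move=> le_Nk; rewrite /Y encodeE; case: (boolP (settled _ _ _ _ k)) => // sk.
    by case: none; exists k.
  have sU i : exists n, seen S q i n.
    apply/(eS q Y) => //; apply: universal_not_MLR => //.
    exact: eventually_zero_not_MLR Y0.
  have [M hM] : exists M, forall i, i < N -> seen S q i M.
    elim: (N) => [|k [M hM]]; first by exists 0.
    have [n sn] := sU k; exists (maxn M n) => i.
    rewrite ltnS leq_eqVlt => /orP[/eqP->|/hM].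
      exact: mS (leq_maxr _ _) sn.
    exact/mS/leq_maxl.
  apply: none; exists (maxn N M); first exact: leq_maxl.
  apply/allP => i _; rewrite [approx T p (maxn _ _)]hN ?leq_maxl //.
  case: (leqP N i) => [/hN->|/hM]; first by rewrite eqxx.
  by move/(mS _ _ _ _ (leq_maxr N M))->; rewrite orbT.
split.
  apply: (@MLR_tail_eq m X) rX => k le_mk.
  by rewrite /Y encodeE (settled_mono m k) // pX; case: (X k).
move=> i nUY; apply: NNPP => ne; apply: nUY; apply/(eS q Y) => //.
(* The stage must exceed [i] so that guess [i] is among those checked; being settled, it then either
   equals [R] or has been refuted. *)
have sn := settled_mono m (maxn m i.+1) le_Nm (leq_maxl _ _) sm.
have := allP sn i; rewrite mem_iota add0n leq_maxr => /(_ isT).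
rewrite (hN (maxn _ _)) ?(leq_trans le_Nm) ?leq_maxl //.
by case/orP=> [/eqP//|s]; exists (maxn m i.+1).
Qed.

(** * The two reductions *)

Lemma bjoin_even p q k : bjoin p q (k + k) = p k.
Proof. by rewrite /bjoin addnn odd_double doubleK. Qed.

Lemma bjoin_odd p q k : bjoin p q (k + k).+1 = q k.
Proof. by rewrite /bjoin /= addnn odd_double /= uphalf_double. Qed.

Lemma RD_le_LAY U V : universal U -> universal V ->
  weihrauch_le delta_MLR delta_nat (RD V) delta_MLR delta_nat (LAY U).
Proof.
move=> uU uV.
have [T sT] := ML_test_stages (proj1 uV); have [S sS] := ML_test_stages (proj1 uU).
have [cT _ _] := sT; have [cS _ _] := sS.
have [ePhi hPhi] := computable_encode cT cS.
(* The odd positions of the oracle carry the characteristic function of the layer returned by the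
   realizer. The test vanishes where that function is nonzero, so [CMu cfind] recovers the layer. *)
have [cfind hfind] : computable (fun o z => o ((unpair z).2 + (unpair z).2).+1 == 0).
  apply: computable_eq; computability; apply: computable_oracle; computability.
  by apply: computable_add; computability.
(* The even positions carry the original input, from which the guess at the recovered layer is
   recomputed and compared with the output position. *)
have [cval hval] :
    computable (fun o z => (unpair z).1 == approx T (fun k => o (k + k)) (unpair z).2).
  apply: computable_eq; computability.
  apply: (@computable_approx _ (fun o _ k => o (k + k))); computability.
  by apply: computable_oracle; computability; apply: computable_add; computability.
exists ePhi, (CComp cval (CPair CId (CMu cfind))) => Gamma hGamma p X [rX pX] [R RDX].
have [rY decY] := encode_correct uU sT sS pX RDX.
have [||r [Gr [i [ri [_ nUY]]]]] := hGamma (fun k => encode T S p k) (encode T S p).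
- by [].
- have [i nUY] := rY _ (proj1 uU); by exists i; split.
exists (fun m => m == R); split; last by exists R.
exists (fun k => encode T S p k), r; split; first by move=> n; apply: hPhi.
split=> // x.
have found n : eval (bjoin p r) cfind (npair x n) (n != i).
  have := hfind (bjoin p r) (npair x n); rewrite npairK /= bjoin_odd ri.
  by case: (n == i).
apply: (@eComp _ _ _ _ (npair x i)).
  apply: ePair; first exact: eId.
  apply: eMu; first by have := found i; rewrite eqxx.
  by move=> m lt_mi; exists 0; have := found m; rewrite neq_ltn lt_mi.
have := hval (bjoin p r) (npair x i); rewrite npairK /=.
suff -> : approx T (fun k => bjoin p r (k + k)) i = R by [].
by rewrite -(decY _ nUY); apply: eq_approx => k; apply: bjoin_even.
Qed.

(** Classical least-index argument. It shows that the two problems have the same domain, which the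
    definition of a realizer asks for. *)
Lemma RD_exists V X i : LAY V X i -> exists j, RD V X j.
Proof.
case=> rX; elim/ltn_ind: i => i IH nV.
case: (classic (exists2 j, j < i & ~ V j X)) => [[j lt_ji]|none]; first exact: IH.
exists i; split=> //; split=> // j lt_ji; apply: NNPP => nVj.
by apply: none; exists j.
Qed.

Theorem theorem5p4 (U V : nat -> cantor -> Prop) :
  universal U -> universal V ->
  weihrauch_equiv delta_MLR delta_nat (RD V) delta_MLR delta_nat (LAY U).
Proof.
move=> uU uV; split; first exact: RD_le_LAY.
(* With the tests exchanged, the same two codes serve: a realizer of [RD V] also realizes [LAY V],
   and the value of [RD U] is a layer for [U]. *)
have [ePhi [ePsi red]] := RD_le_LAY uV uU.
exists ePhi, ePsi => Gamma hGamma p X pX [i /RD_exists dom].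
have [|s [comp_s [j [sj [rX [nUX _]]]]]] := red Gamma _ p X pX dom.
  move=> q Y qY [k /RD_exists domY].
  have [r [Gr [l [rl [rY [nVY _]]]]]] := hGamma q Y qY domY.
  by exists r; split=> //; exists l.
by exists s; split=> //; exists j.
Qed.
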